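(* Let $p$ be a prime and $q$ a power of $p$. For every integer $m\ge 2$, the orthogonal group $\mathrm{O}(2m,\overline{\mathbb{F}_q})$ is not acceptable.
   Context: $\overline{\mathbb{F}_q}$ denotes an algebraic closure of the finite field $\mathbb{F}_q$. Let $\Lambda_m$ be the $m\times m$ matrix with $1$'s on the antidiagonal and $0$ elsewhere, and let $J_e=\begin{pmatrix}0&\Lambda_m\\\Lambda_m&0\end{pmatrix}$. Then $\mathrm{O}(2m,\overline{\mathbb{F}_q})=\{A\in\mathrm{GL}(2m,\overline{\mathbb{F}_q}) : {}^tAJ_eA=J_e\}$. Let $\Gamma$ be a group and $H$ a finite group. Two homomorphisms $\phi_1,\phi_2:H\to\Gamma$ are element-conjugate if for every $x\in H$ there is $h(x)\in\Gamma$ with $\phi_1(x)=h(x)^{-1}\phi_2(x)h(x)$; they are globally conjugate if one can choose a single $h\in\Gamma$ with $\phi_1(x)=h^{-1}\phi_2(x)h$ for all $x\in H$. The group $\Gamma$ is acceptable if for every finite group $H$, any two element-conjugate homomorphisms $H\to\Gamma$ are globally conjugate. *)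

(* Defs.v *)
From HB Require Import structures.
From mathcomp Require Import all_boot all_order all_algebra all_fingroup.

Set Implicit Arguments.
Unset Strict Implicit.
Unset Printing Implicit Defensive.

Import GRing.Theory.

(* MathComp has no notation for group homomorphisms; a morphism of unitary
   magmas between two groups is exactly a group homomorphism. *)
Notation group_hom H G := (UMagmaMorphism.type H G).

(* The library's x ^ h is h^-1 * (x * h). *)
Definition element_conjugate (G : groupType) (H : finGroupType)
    (phi1 phi2 : group_hom H G) : Prop :=
  forall x : H, exists h : G, phi1 x = (phi2 x ^ h)%g.

Definition globally_conjugate (G : groupType) (H : finGroupType)
    (phi1 phi2 : group_hom H G) : Prop :=
  exists h : G, forall x : H, phi1 x = (phi2 x ^ h)%g.

Definition acceptable (G : groupType) : Prop :=
  forall (H : finGroupType) (phi1 phi2 : group_hom H G),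
    element_conjugate phi1 phi2 -> globally_conjugate phi1 phi2.

Local Open Scope ring_scope.

Definition antidiag_mx (R : nzRingType) (m : nat) : 'M[R]_m :=
  \matrix_(i, j) (j == rev_ord i)%:R.

Definition even_form (R : nzRingType) (m : nat) : 'M[R]_(m + m) :=
  block_mx 0 (antidiag_mx R m) (antidiag_mx R m) 0.

Definition is_orthogonal (K : fieldType) (m : nat) : pred 'M[K]_(m + m) :=
  fun A => (A \in unitmx) && (A^T *m even_form K m *m A == even_form K m).

(* In characteristic 2 this group is all of Sp(2m, K): it is cut out by the
   bilinear form alone, with no quadratic form involved. *)
Record orthogonal_group (K : fieldType) (m : nat) : Type := Orthogonal {
  orthogonal_val :> 'M[K]_(m + m);
  orthogonal_valP : is_orthogonal orthogonal_val
}.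

Section OrthogonalGroup.
Variables (K : fieldType) (m : nat).
Local Notation O := (orthogonal_group K m).

HB.instance Definition _ := [isSub for @orthogonal_val K m].
HB.instance Definition _ := [Choice of O by <:].

Fact orthogonal1 : is_orthogonal (1%:M : 'M[K]_(m + m)).
Proof. by rewrite /is_orthogonal unitmx1 trmx1 mul1mx mulmx1 eqxx. Qed.

Fact orthogonalM (A B : 'M[K]_(m + m)) :
  is_orthogonal A -> is_orthogonal B -> is_orthogonal (A *m B).
Proof.
move=> /andP[uA /eqP AJ] /andP[uB /eqP BJ].
rewrite /is_orthogonal unitmx_mul uA uB trmx_mul /=.
by rewrite mulmxA -(mulmxA B^T) -(mulmxA B^T) AJ BJ.
Qed.

Fact orthogonalV (A : 'M[K]_(m + m)) :
  is_orthogonal A -> is_orthogonal (invmx A).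
Proof.
move=> /andP[uA /eqP AJ]; rewrite /is_orthogonal unitmx_inv uA /=.
apply/eqP; rewrite -{1}AJ trmx_inv mulmxA -mulmxA mulmxV // mulmx1.
by rewrite mulmxA mulVmx ?unitmx_tr // mul1mx.
Qed.

Definition orthogonal_one : O := Orthogonal orthogonal1.
Definition orthogonal_mul (A B : O) : O :=
  Orthogonal
    (orthogonalM (orthogonal_valP A) (orthogonal_valP B)).
Definition orthogonal_inv (A : O) : O :=
  Orthogonal (orthogonalV (orthogonal_valP A)).

Fact orthogonal_mulA : associative orthogonal_mul.
Proof. by move=> A B C; apply: val_inj; apply: mulmxA. Qed.
Fact orthogonal_mul1 : left_id orthogonal_one orthogonal_mul.
Proof. by move=> A; apply: val_inj; apply: mul1mx. Qed.
Fact orthogonal_mulr1 : right_id orthogonal_one orthogonal_mul.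
Proof. by move=> A; apply: val_inj; apply: mulmx1. Qed.
Fact orthogonal_mulV :
  left_inverse orthogonal_one orthogonal_inv orthogonal_mul.
Proof.
by move=> A; apply: val_inj; apply: mulVmx; case/andP: (valP A).
Qed.
Fact orthogonal_mulrV :
  right_inverse orthogonal_one orthogonal_inv orthogonal_mul.
Proof.
by move=> A; apply: val_inj; apply: mulmxV; case/andP: (valP A).
Qed.

HB.instance Definition _ := isGroup.Build O
  orthogonal_mulA orthogonal_mul1 orthogonal_mulr1
  orthogonal_mulV orthogonal_mulrV.

End OrthogonalGroup.

(* Main.v *)
Require Import Defs.
From HB Require Import structures.
From mathcomp Require Import all_boot all_order all_algebra all_fingroup.

(** Why the theorem holds.  In positive characteristic a finite group can have
    many unipotent representations.  Let [Y = E_01 - E_10], for which [m >= 2]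
    is needed.  As [Y^T = - Y], the matrices [u t = [1, t X; 0, 1]] with
    [X = Lambda Y] form a one-parameter subgroup of the orthogonal group,
    isomorphic to the additive group of [K] ([skew_root_mul]); it lies in the
    unipotent radical of the stabilizer of a maximal isotropic subspace.

    All the [u t] with [t != 0] are conjugate: the block matrices
    [diag (c, c^-1)] are orthogonal, they rescale [t] by a square, and every
    element of [K] is a square ([skew_root_conj], [closed_field_sqrt]).  On the
    other hand the [u t - 1] form a line of matrices and conjugation is linear,
    so an element that centralizes [u 1] centralizes every [u t]
    ([skew_root_conj_rigid]).

    Now choose [a] in [K] outside the finite field [F], and let [F * F] act
    through [(x, y) |-> u (x + y a)] and [(x, y) |-> u (x + y (a + 1))].  Both
    parameters vanish only at [(0, 0)], hence the two homomorphisms are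
    element-conjugate; they agree on [(1, 0)] but differ on [(0, 1)], so
    rigidity forbids a global conjugation.  The sign in the skewness
    of [Y] is harmless in characteristic 2, where the same formulas describe
    the symplectic group; all characteristics are treated at once. *)

Set Implicit Arguments.
Unset Strict Implicit.
Unset Printing Implicit Defensive.

Import GRing.Theory.
Local Open Scope ring_scope.

(** * Unipotent and diagonal blocks in the orthogonal group *)

Section Blocks.
Variables (K : fieldType) (m : nat).
Local Notation L := (antidiag_mx K m).

Lemma tr_antidiag_mx : L^T = L.
Proof.
apply/matrixP=> i j; rewrite !mxE.
by rewrite -(inj_eq rev_ord_inj) rev_ordK eq_sym.
Qed.

Lemma antidiag_mxK : L *m L = 1%:M.
Proof.
apply/matrixP=> i j; rewrite !mxE (bigD1 (rev_ord i)) //= big1 => [|k /negPf nk].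
  by rewrite !mxE eqxx mul1r addr0 rev_ordK eq_sym.
by rewrite !mxE nk mul0r.
Qed.

Definition unipotent_mx (X : 'M[K]_m) : 'M[K]_(m + m) :=
  block_mx 1%:M X 0 1%:M.

Lemma unipotent_mxD X Z :
  unipotent_mx (X + Z) = unipotent_mx X *m unipotent_mx Z.
Proof.
rewrite /unipotent_mx mulmx_block !mulmx0 !mul0mx !mulmx1 !mul1mx.
by rewrite !addr0 add0r addrC.
Qed.

Lemma unipotent_mx_orthogonal X :
  L *m X + X^T *m L = 0 -> Defs.is_orthogonal (unipotent_mx X).
Proof.
move=> skewX; rewrite /Defs.is_orthogonal; apply/andP; split.
  have /mulmx1_unit[] // : unipotent_mx X *m unipotent_mx (- X) = 1%:M.
  by rewrite -unipotent_mxD subrr /unipotent_mx -scalar_mx_block.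
rewrite /unipotent_mx /even_form tr_block_mx !mulmx_block trmx0 !trmx1.
rewrite !(mulmx0, mul0mx, mul1mx, mulmx1, addr0, add0r).
by rewrite skewX eqxx.
Qed.

Lemma diag_block_orthogonal (c : K) : c != 0 ->
  Defs.is_orthogonal (block_mx c%:M 0 0 c^-1%:M : 'M[K]_(m + m)).
Proof.
move=> nz_c; rewrite /Defs.is_orthogonal; apply/andP; split.
  have /mulmx1_unit[] // : (block_mx c%:M 0 0 c^-1%:M : 'M[K]_(m + m))
      *m block_mx c^-1%:M 0 0 c%:M = 1%:M.
  rewrite mulmx_block !mulmx0 !mul0mx !(addr0, add0r) -!scalar_mxM.
  by rewrite mulfV // mulVf // -scalar_mx_block.
rewrite /even_form tr_block_mx !mulmx_block !trmx0 !tr_scalar_mx.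
rewrite !(mulmx0, mul0mx, addr0, add0r) !mul_scalar_mx !mul_mx_scalar.
by rewrite !scalerA mulfV // mulVf // !scale1r eqxx.
Qed.

(** Conjugacy as an identity of matrices without inverses: block products and
    linearity in the conjugated element apply to this form directly. *)
Lemma orthogonal_conjP (g1 g2 h : orthogonal_group K m) :
  g1 = (g2 ^ h)%g <-> \val h *m \val g1 = \val g2 *m \val h.
Proof.
split=> [-> | eq_h]; first exact: (congr1 val (mulKVg h (g2 * h)%g)).
by apply: (mulgI h); rewrite /conjg mulKVg; apply: val_inj.
Qed.

End Blocks.

(** * The one-parameter subgroup of a skew matrix *)

Section SkewRoot.
Variables (K : fieldType) (m : nat).
Local Notation L := (antidiag_mx K m).
Local Notation O := (orthogonal_group K m).

(** The skew matrix [E_01 - E_10]; the indices are compared as numbers so that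
    [m] may stay arbitrary. *)
Definition skew_mx : 'M[K]_m :=
  \matrix_(i, j) (((i == 0 :> nat) && (j == 1 :> nat))%:R
                  - ((i == 1 :> nat) && (j == 0 :> nat))%:R).

Lemma tr_skew_mx : skew_mx^T = - skew_mx.
Proof.
by apply/matrixP=> i j; rewrite !mxE opprB; congr (_%:R - _%:R); rewrite andbC.
Qed.

Lemma skew_mx_neq0 : (2 <= m)%N -> skew_mx != 0.
Proof.
move=> m_ge2; apply/eqP=> /matrixP/(_ (Ordinal (ltnW m_ge2)) (Ordinal m_ge2)).
by rewrite !mxE /= subr0 => /eqP; rewrite oner_eq0.
Qed.

Definition root_mx : 'M[K]_m := L *m skew_mx.

Lemma root_mx_neq0 : (2 <= m)%N -> root_mx != 0.
Proof.
move/skew_mx_neq0; apply: contraNneq => rootK0.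
by rewrite -[skew_mx]mul1mx -antidiag_mxK -mulmxA -/root_mx rootK0 mulmx0.
Qed.

Lemma root_mx_orthogonal (t : K) : Defs.is_orthogonal (unipotent_mx (t *: root_mx)).
Proof.
apply: unipotent_mx_orthogonal.
rewrite !linearZ /= -scalemxAl -scalerDr.
rewrite /root_mx mulmxA antidiag_mxK mul1mx trmx_mul tr_antidiag_mx -mulmxA.
by rewrite antidiag_mxK mulmx1 tr_skew_mx subrr scaler0.
Qed.

Definition skew_root (t : K) : O := Orthogonal (root_mx_orthogonal t).

Lemma skew_root_mul s t : skew_root (s + t) = (skew_root s * skew_root t)%g.
Proof. by apply: val_inj; rewrite /= scalerDl unipotent_mxD. Qed.

Lemma skew_root1 : skew_root 0 = 1%g.
Proof.
by apply: val_inj; rewrite /= scale0r /unipotent_mx -scalar_mx_block.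
Qed.

(** Conjugation by [diag (c, c^-1)] divides the parameter by [c ^+ 2]. *)
Lemma skew_root_conj (c t : K) : c != 0 ->
  exists h : O, skew_root t = (skew_root (c ^+ 2 * t) ^ h)%g.
Proof.
move=> nz_c; exists (Orthogonal (diag_block_orthogonal m nz_c)).
apply/orthogonal_conjP => /=.
rewrite /unipotent_mx !mulmx_block !mulmx0 !mul0mx !mulmx1 !mul1mx.
rewrite !(addr0, add0r) mul_scalar_mx mul_mx_scalar !scalerA.
by rewrite expr2 -mulrA mulKf.
Qed.

(** Write [u t = 1 + t N].  If [h] conjugates [u 1] to itself then
    [h N = N h], and if it also conjugates [u b] to [u a] then
    [a h N = b N h = b h N] with [h N != 0]. *)
Lemma skew_root_conj_rigid (h : O) (a b : K) : (2 <= m)%N ->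
    skew_root 1 = (skew_root 1 ^ h)%g -> skew_root a = (skew_root b ^ h)%g ->
  a = b.
Proof.
move=> m_ge2 /orthogonal_conjP/= h1 /orthogonal_conjP/= hab.
pose N : 'M[K]_(m + m) := block_mx 0 root_mx 0 0.
have uE t : unipotent_mx (t *: root_mx) = 1%:M + t *: N.
  rewrite /unipotent_mx /N scale_block_mx scalar_mx_block add_block_mx.
  by rewrite !scaler0 !addr0 add0r.
have nz_N : N != 0.
  apply: contra (root_mx_neq0 m_ge2) => /eqP N0.
  apply/eqP; apply/matrixP=> i j; move/matrixP/(_ (lshift m i) (rshift m j)): N0.
  by rewrite block_mxEur !mxE.
set H : 'M_(m + m) := orthogonal_val h in h1 hab.
have unitH : H \in unitmx by case/andP: (orthogonal_valP h).
have linear_conj s t : H *m unipotent_mx (s *: root_mx)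
    = unipotent_mx (t *: root_mx) *m H -> s *: (H *m N) = t *: (N *m H).
  rewrite !uE mulmxDr mulmxDl mulmx1 mul1mx -scalemxAr -scalemxAl.
  by move/addrI.
have HN : H *m N = N *m H by have:= linear_conj _ _ h1; rewrite !scale1r.
have /eqP := linear_conj _ _ hab; rewrite -HN -subr_eq0 -scalerBl.
rewrite scaler_eq0 subr_eq0 => /orP[/eqP // | /eqP HN0].
by case/eqP: nz_N; rewrite -(mulKmx unitH N) HN0 mulmx0.
Qed.

End SkewRoot.

(** * Two homomorphisms from the plane over a finite field *)

Lemma closed_field_sqrt (K : closedFieldType) (z : K) : exists c, c ^+ 2 = z.
Proof.
have /closed_rootP[c] : size ('X^2 - z%:P) != 1%N by rewrite size_XnsubC.
by rewrite rootE !hornerE subr_eq0 => /eqP; exists c.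
Qed.

Lemma closed_field_notin_codom (T : finType) (K : closedFieldType)
  (f : T -> K) : exists a, forall x, f x != a.
Proof.
have /closed_nonrootP[a] : \prod_(z <- codom f) ('X - z%:P) != 0.
  by rewrite monic_neq0 ?monic_prod_XsubC.
rewrite root_prod_XsubC => a_notin; exists a => x.
by apply: contraNneq a_notin => <-; apply: codom_f.
Qed.

Section PlaneHom.
Variables (F : finFieldType) (K : closedFieldType) (iota : {rmorphism F -> K}).
Variable m : nat.

Definition plane_param (a : K) (x : F * F) : K := iota x.1 + iota x.2 * a.

Definition plane_hom (a : K) (x : F * F) : orthogonal_group K m :=
  skew_root m (plane_param a x).

Fact plane_hom_monoid_morphism a : monoid.monoid_morphism (plane_hom a).
Proof.
split=> [|x y]; rewrite /plane_hom.
  by rewrite /plane_param !rmorph0 mul0r addr0 skew_root1.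
by rewrite -skew_root_mul /plane_param /= !rmorphD mulrDl addrACA.
Qed.

HB.instance Definition _ a :=
  isUMagmaMorphism.Build (F * F)%type (orthogonal_group K m) (plane_hom a)
    (plane_hom_monoid_morphism a).

(** If [a] lies outside [F], then [1] and [a] are linearly independent over
    [F]; this keeps the parameters of nonzero vectors in the single conjugacy
    class of the [u t] with [t != 0]. *)
Lemma plane_param_eq0 a x : (forall z, iota z != a) ->
  (plane_param a x == 0) = (x == 0).
Proof.
case: x => x y a_notin; rewrite /plane_param /= xpair_eqE /=.
have [-> | nz_y] /= := eqVneq y 0.
  by rewrite rmorph0 mul0r addr0 fmorph_eq0 andbT.
rewrite andbF; apply: contraNF (a_notin (- x / y)).
rewrite addrC addr_eq0 => /eqP yaE.
by rewrite fmorph_div rmorphN -yaE mulrAC mulfV ?mul1r // fmorph_eq0.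
Qed.

Lemma plane_hom_element_conjugate a b :
    (forall z, iota z != a) -> (forall z, iota z != b) ->
  element_conjugate (plane_hom a) (plane_hom b).
Proof.
move=> a_notin b_notin x; rewrite /= /plane_hom.
have [-> | nz_x] := eqVneq x (0, 0).
  by exists 1%g; rewrite conjg1 /plane_param /= !rmorph0 !mul0r.
have nz_a : plane_param a x != 0 by rewrite plane_param_eq0.
have nz_b : plane_param b x != 0 by rewrite plane_param_eq0.
(* Conjugation by [diag (c, c^-1)] carries the parameter for [b] to the one
   for [a]. *)
have [c c2E] := closed_field_sqrt (plane_param b x / plane_param a x).
have nz_c : c != 0 by rewrite -sqrf_eq0 c2E mulf_neq0 ?invr_neq0.
have [h] := skew_root_conj m (plane_param a x) nz_c.
by rewrite c2E divfK //; exists h.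
Qed.

(** The two homomorphisms agree on [(1, 0)], where both give [u 1], so rigidity
    applies to the images [u a] and [u b] of [(0, 1)]. *)
Lemma plane_hom_globally_conjugate a b : (2 <= m)%N ->
  globally_conjugate (plane_hom a) (plane_hom b) -> a = b.
Proof.
move=> m_ge2 [h conj_h]; apply: (@skew_root_conj_rigid K m h) => //.
  have:= conj_h (1, 0); rewrite /= /plane_hom /plane_param /=.
  by rewrite rmorph1 rmorph0 !mul0r addr0.
have:= conj_h (0, 1); rewrite /= /plane_hom /plane_param /=.
by rewrite rmorph1 rmorph0 !mul1r !add0r.
Qed.

End PlaneHom.

Unset Implicit Arguments.

Theorem theorem6p10 (p q : nat) (hp : prime p)
    (hq : exists2 n : nat, (0 < n)%N & q = (p ^ n)%N)
    (F : finFieldType) (hF : #|F| = q)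
    (K : closedFieldType) (iota : {rmorphism F -> K})
    (hK : forall z : K, algebraicOver iota z)
    (m : nat) (hm : (2 <= m)%N) :
  ~ acceptable (orthogonal_group K m).
Proof.
(* The second parameter can be [a + 1]: it differs from [a], and it also lies
   outside [F]. *)
move=> accO; have [a a_notin] := closed_field_notin_codom iota.
have a1_notin z : iota z != a + 1.
  by rewrite -subr_eq -(rmorph1 iota) -rmorphB.
have /accO/(plane_hom_globally_conjugate hm) :=
  plane_hom_element_conjugate m a_notin a1_notin.
by move/eqP; rewrite addrC -subr_eq subrr eq_sym oner_eq0.
Qed.
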